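(* Consider a set of producers $\mathcal N$, production cost functions $C_i$ for every $i\in\mathcal N$, and a demand function $D$. Then: (i) the activation price game admits a (pure strategy) Nash equilibrium. Moreover, (ii) for every Nash equilibrium $x^*$ of the activation price game, the set of active players is $$\mathcal N_{\mathrm a}(x^* )=\{i\in\mathcal N:\ C_i'(0)<\overline p(x^* )\}.$$ As a consequence, for every Nash equilibrium $x^*$ of the activation price game: (iii) if $i,j\in\mathcal N$ satisfy $C_i'(0)\le C_j'(0)$ and $j\in\mathcal N_{\mathrm a}(x^* )$, then $i\in\mathcal N_{\mathrm a}(x^* )$; (iv) if $C_i'(0)=c<\hat p$ for every $i\in\mathcal N$, then $\mathcal N_{\mathrm a}(x^* )=\mathcal N$.
   Context: Notation: $\mathbb R_+=[0,\infty)$, $[t]_+=\max\{t,0\}$. Market: $\mathcal N=\{1,\dots,n\}$ is a non-empty finite set of producers. Each production cost function $C_i:\mathbb R_+\to\mathbb R_+$ is twice continuously differentiable, non-decreasing and convex. The demand function $D:\mathbb R_+\to\mathbb R$ is twice continuously differentiable, strictly decreasing, with $D(0)>0$, $\hat p:=\sup\{p\ge 0: D(p)>0\}<+\infty$, and $D$ concave on $[0,\hat p]$. Activation price game: the strategic game with player set $\mathcal N$, in which each player $i$ chooses $x_i\in[0,\hat p]$; for $x\in\mathcal X=[0,\hat p]^{\mathcal N}$ the market-clearing price $\overline p(x)$ is the unique $\overline p\in[0,\hat p]$ with $D(\overline p)=\sum_{i=1}^n[\overline p-x_i]_+$, and the utility of player $i$ is $$\overline u_i(x)=\overline p\,[\overline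 p-x_i]_+-\tfrac12[\overline p-x_i]_+^2-C_i([\overline p-x_i]_+),\qquad \overline p=\overline p(x).$$ $x^*$ is a Nash equilibrium if for every $i$, $x_i^*$ maximizes $\overline u_i(\cdot,x_{-i}^* )$ over $[0,\hat p]$. The set of active players at $x\in\mathcal X$ is $\mathcal N_{\mathrm a}(x):=\{i\in\mathcal N:\ x_i<\overline p(x)\}$. *)

(* Defs.v *)
From HB Require Import structures.
From mathcomp Require Import all_boot all_order all_algebra.
From mathcomp Require Import all_classical all_reals all_analysis.
Set Implicit Arguments.
Unset Strict Implicit.
Unset Printing Implicit Defensive.
Import Order.TTheory GRing.Theory Num.Theory.
Import numFieldNormedType.Exports.
Local Open Scope classical_set_scope.
Local Open Scope ring_scope.

(* Functions with domain [0, +oo[ are represented by total functions R -> R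
   whose values outside [0, +oo[ are never used.  Accordingly, derivatives are
   relative to a set A: the difference quotient is only taken along points
   of A, so that it is one-sided at an end point of A. *)
Section RelativeDerivative.
Context {R : realType}.
Implicit Types (A : set R) (f : R -> R).

Definition diff_quotient f (x y : R) : R := (f y - f x) / (y - x).

Definition derivable_within A f (x : R) : Prop :=
  cvg (diff_quotient f x y @[y --> within A x^']).

Definition derive_within A f (x : R) : R :=
  lim (diff_quotient f x y @[y --> within A x^']).

Definition twice_continuously_differentiable A f : Prop :=
  [/\ forall x, A x -> derivable_within A f x,
      forall x, A x -> derivable_within A (derive_within A f) x &
      {within A, continuous (derive_within A (derive_within A f))}].

End RelativeDerivative.

Section Game.
Context {I : eqType} {R : realType}.

Definition nash_equilibrium (S : I -> set R) (u : I -> (I -> R) -> R)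
    (x : I -> R) : Prop :=
  (forall i, S i (x i)) /\
  forall i y, S i y -> u i [eta x with i |-> y] <= u i x.

End Game.

Section Market.
Context {R : realType}.

Definition nonneg_reals : set R := `[0, +oo[.

Definition is_cost_function (C : R -> R) : Prop :=
  [/\ {in nonneg_reals, forall q, 0 <= C q},
      twice_continuously_differentiable nonneg_reals C,
      {in nonneg_reals &, {homo C : q r / q <= r}} &
      @convex_function R R^o nonneg_reals C].

Definition marginal_cost (C : R -> R) : R -> R := derive_within nonneg_reals C.

Definition positive_demand_prices (D : R -> R) : set R :=
  [set p | 0 <= p /\ 0 < D p].

(* \hat p; real-valued sup, meaningful as positive_demand_prices D is nonempty
   (0 < D 0) and bounded in is_demand_function below. *)
Definition max_price (D : R -> R) : R := sup (positive_demand_prices D).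

Definition price_range (D : R -> R) : set R := `[0, max_price D].

Definition is_demand_function (D : R -> R) : Prop :=
  [/\ twice_continuously_differentiable nonneg_reals D,
      {in nonneg_reals &, {homo D : p q /~ p < q}},
      0 < D 0,
      has_ubound (positive_demand_prices D) &
      @convex_function R R^o (price_range D) (\- D)].

Context {n : nat}.
Implicit Types (D : R -> R) (C : 'I_n -> R -> R) (x : 'I_n -> R).

Definition quantity (p a : R) : R := Num.max (p - a) 0.

Definition clears_market D x (p : R) : Prop :=
  price_range D p /\ D p = \sum_(i < n) quantity p (x i).

(* The default value 0 is irrelevant, by clearing_price_unique below. *)
Definition clearing_price D x : R := xget 0 (clears_market D x).

Definition utility D C (i : 'I_n) x : R :=
  let p := clearing_price D x in
  let q := quantity p (x i) in
  p * q - q ^+ 2 / 2 - C i q.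

Definition activation_price_NE D C x : Prop :=
  nash_equilibrium (fun=> price_range D) (utility D C) x.

Definition active_set D x : set 'I_n := [set i | x i < clearing_price D x].

End Market.

Section ClearingPrice.
Context {R : realType}.

Lemma derivable_within_continuous (A : set R) (f : R -> R) (x : R) :
  derivable_within A f x -> f @ within A (nbhs x) --> f x.
Proof.
move=> dfx.
have idx : (fun y : R => y - x) @ within A x^' --> x - x.
  apply: cvgB; last exact: cvg_cst.
  by apply: cvg_within_filter; apply: cvg_within_filter; exact: cvg_id.
have cvg' : f @ within A x^' --> f x.
  pose g y := f x + diff_quotient f x y * (y - x).
  have cg : g @ within A x^' --> f x.
    have := cvgD (cvg_cst (f x)) (cvgM dfx idx).
    by rewrite subrr mulr0 addr0; apply.
  suff E : {near within A x^', g =1 f}.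
    by apply: cvg_trans cg; exact: near_eq_cvg.
  have : within A x^' [set y | y != x].
    by apply: (cvg_within (F := x^')); exact: withinT.
  apply: filterS => y /= yx.
  by rewrite /g /diff_quotient mulfVK ?subr_eq0// addrC subrK.
move=> U Ufx; 
have H : \forall y \near x, y != x -> A y -> U (f y) := cvg' _ Ufx.
suff : \forall y \near x, A y -> U (f y) by [].
apply: filterS H => y yU Ay.
have [->|yx] := eqVneq y x; first exact: nbhs_singleton.
exact: yU.
Qed.

Lemma demand_max_price (D : R -> R) : is_demand_function D ->
  0 < max_price D /\ D (max_price D) = 0.
Proof.
move=> [[dD _ _] decD D0 ubD _].
have mem (p : R) : 0 <= p -> p \in @nonneg_reals R.
  by move=> p0; rewrite inE /nonneg_reals /= in_itv /= p0.
have cD (p : R) : 0 <= p -> D @ within nonneg_reals (nbhs p) --> D p.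
  by move=> p0; apply: derivable_within_continuous; apply: dD; have := mem _ p0; rewrite inE.
have S0 : positive_demand_prices D 0 by split.
have supS : has_sup (positive_demand_prices D) by split => //; exists 0.
have up p : positive_demand_prices D p -> p <= max_price D.
  by move=> Sp; exact: ub_le_sup.
have lt_up p : positive_demand_prices D p -> p < max_price D.
  move=> [p0 Dp0].
  have /= : nbhs (D p) [set y | 0 < y] by exact: lt_nbhsr.
  move=> /(cD _ p0) H.
  have [e /= e0 He] : \forall y \near p, nonneg_reals y -> 0 < D y := H.
  have : positive_demand_prices D (p + e / 2).
    split; first by rewrite addr_ge0// ltW// divr_gt0.
    apply: (He (p + e / 2)) => /=; last first.
      by rewrite /nonneg_reals /= in_itv /= andbT addr_ge0// ltW// divr_gt0.
    by rewrite opprD addNKr normrN gtr0_norm ?divr_gt0// ltr_pdivrMr// mulr_natr mulr2n ltrDl.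
  by move=> /up; apply: lt_le_trans; rewrite ltrDl divr_gt0.
have m0 : 0 < max_price D by exact: lt_up.
split=> //; apply/eqP; rewrite eq_le; apply/andP; split; rewrite leNgt; apply/negP => Dm.
  have : positive_demand_prices D (max_price D) by split => //; exact: ltW.
  by move/lt_up; rewrite ltxx.
have /= : nbhs (D (max_price D)) [set y | y < 0] by exact: lt_nbhsl.
move=> /(cD _ (ltW m0)) H.
have [e /= e0 He] : \forall y \near max_price D, nonneg_reals y -> D y < 0 := H.
have [p [p0 Dp] pe] := sup_adherent e0 supS.
have pm := lt_up _ (conj p0 Dp).
have := He p; rewrite /= gtr0_norm ?subr_gt0// => /(_ _ _).
rewrite ltrBlDr -ltrBlDl ltrBlDr -ltrBlDr pe => /(_ isT).
have := mem _ p0; rewrite inE => np /(_ np).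
by rewrite ltNge (ltW Dp).
Qed.

Lemma clearing_price_unique n (D : R -> R) (x : 'I_n -> R) :
  is_demand_function D -> (forall i, price_range D (x i)) ->
  forall p, clears_market D x p <-> p = clearing_price D x.
Proof.
move=> hD xX.
have [m0 Dm] := demand_max_price hD.
case: hD => -[dD _ _] decD D0 ubD _.
pose S p := \sum_(i < n) quantity p (x i).
have leS p r : p <= r -> S p <= S r.
  move=> pr; apply: ler_sum => i _; rewrite /quantity.
  by rewrite ge_max !le_max lexx orbT andbT lerB.
have uniq p r : clears_market D x p -> clears_market D x r -> p = r.
  wlog pr : p r / p <= r.
    move=> W hp hr; case: (leP p r) => [/W|/ltW/W]; first exact.
    by move=> /(_ hr hp).
  move=> [pI Dp] [rI Dr]; apply/eqP; rewrite eq_le pr /= leNgt; apply/negP => plt.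
  have nn q : price_range D q -> q \in @nonneg_reals R.
    rewrite inE /price_range /nonneg_reals /= !in_itv /= andbT.
    by case/andP.
  have := decD _ _ (nn _ rI) (nn _ pI) plt.
  by rewrite Dp Dr ltNge leS// ltW.
suff [p hp] : exists p, clears_market D x p.
  move=> r; split=> [hr|->]; last by apply: xgetPex; exists p.
  by apply: uniq => //; apply: xgetPex; exists p.
have cg : {within `[0, max_price D], continuous (fun p => D p - S p)}.
  apply/subspace_continuousP => p /= pI; apply: cvgB.
    apply: (@cvg_trans _ (D @ within nonneg_reals (nbhs p))).
      apply: cvg_app; apply: within_subset.
      by move=> q; rewrite /nonneg_reals /= !in_itv /= andbT => /andP[].
    apply: derivable_within_continuous; apply: dD.
    by move: pI; rewrite /nonneg_reals /= !in_itv /= andbT => /andP[].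
  apply: cvg_within_filter; rewrite /S.
  elim: (index_enum _) => [|i s IH].
    by under eq_fun do rewrite big_nil; rewrite big_nil; exact: cvg_cst.
  under eq_fun do rewrite big_cons; rewrite big_cons; apply: cvgD => //.
  apply: (@continuous_max R R (fun p => p - x i) (cst 0)); last exact: cvg_cst.
  by apply: cvgB; [exact: cvg_id|exact: cvg_cst].
have g0 : 0 <= D 0 - S 0.
  rewrite /S big1 ?subr0 ?ltW// => i _; rewrite /quantity sub0r.
  apply/max_idPr; rewrite oppr_le0.
  by have := xX i; rewrite /price_range /= in_itv /= => /andP[].
have gm : D (max_price D) - S (max_price D) <= 0.
  rewrite Dm sub0r oppr_le0; apply: sumr_ge0 => i _.
  by rewrite le_max lexx orbT.
have [|p pI /eqP] := @IVT R _ 0 (max_price D) 0 (ltW m0) cg.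
  by rewrite ge_min gm orbT le_max g0.
by rewrite subr_eq0 => /eqP Dp; exists p.
Qed.

End ClearingPrice.

(* Main.v *)
Require Import Defs.
From mathcomp Require Import all_boot all_order all_algebra.
From mathcomp Require Import all_classical all_reals all_analysis.
From mathcomp Require Import ring lra.
Import Order.TTheory GRing.Theory Num.Theory.
Import numFieldNormedType.Exports.
Local Open Scope classical_set_scope.
Local Open Scope ring_scope.

(** Existence needs only the intermediate value theorem.  Look for an
    equilibrium in which every producer bids [x_j <= p], where [p] is the
    clearing price; an inactive producer then bids exactly [p].  With
    [q_j = p - x_j], the tangent inequality for the concave demand and
    [[p' - x_j]_+ >= q_j + (p' - p)] show that the residual demand faced by
    producer [i] lies below the line of slope [- s] through [(p, q_i)], where
    [s = - D'(p) + n - 1]: whatever producer [i] bids, the resulting pair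
    [(p', q')] satisfies [q' <= q_i - s (p' - p)] ([residual_demand_le]).
    Against such a line, the quantity maximizing the profit at [p] solves
    [(1 + s) q + s (C_i'(q) - C_i'(0)) = s [p - C_i'(0)]_+], which for
    [C_i'(0) <= p] is the first order condition [q = s (p - q - C_i'(q))]; by
    convexity of [C_i] no pair [(p', q')] below the line does better
    ([supply_optimal]).  The left-hand side of the equation is strongly
    increasing in [q], so the solution [supply (C_i) s [p - C_i'(0)]_+] exists,
    is unique and depends continuously on [p].  At [p = 0] all supplies vanish
    and [D] is positive; at the maximal price [D] vanishes and all supplies are
    nonnegative.  Hence demand meets total supply at some [p]
    ([clearing_supply_exists]), and the bids [p - q_i] form a Nash equilibrium.

    The active set is read off from two deviations.  A producer selling
    [q > 0] with [C_i'(0) >= p] earns less than [- C_i(0)], which bidding the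
    maximal price guarantees ([NE_active_marginal_cost]).  An inactive producer
    with [C_i'(0) < p] gains by bidding slightly below [p]: the new price lies
    between this bid and [p], so that a small quantity is sold at a price above
    its marginal cost ([NE_marginal_cost_active]).  Finally, if all the
    marginal costs at 0 equal [c] and the price were at most [c], no producer
    would be active, so the demand would vanish and the price would be maximal
    ([NE_price_gt]). *)

(** * Derivatives relative to a set *)

Section WithinDerivative.
Context {R : realType}.
Implicit Types (A : set R) (f : R -> R).

Lemma convex_function_segment A f (x y t : R) :
  @convex_function R R^o A f -> A x -> A y -> 0 <= t <= 1 ->
  f (x + t * (y - x)) <= f x + t * (f y - f x).
Proof.
move=> cf Ax Ay /andP[t0 t1].
have t01 : Itv.spec (Itv.num_sem (R:=R)) (Itv.Real `[0%Z, 1%Z]) t.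
  by rewrite /= /Itv.num_sem /= in_itv /= t0 t1 num_real.
have : f (t * y + (1 - t) * x) <= t * f y + (1 - t) * f x.
  by apply: (cf (Itv.mk t01) y x); rewrite inE.
by congr (_ <= _); [congr f|]; ring.
Qed.

(** Limits along a segment determine the derivative relative to [A], and
    [0^'+] is a proper filter, which [within A x^'] need not be. *)
Lemma cvg_segment_within_dnbhs A (x y : R) : x != y ->
  (forall t : R, 0 < t <= 1 -> A (x + t * (y - x))) ->
  x + t * (y - x) @[t --> 0^'+] --> within A x^'.
Proof.
move=> xy segA U /= [e /= e0 He].
have d0 : 0 < `|y - x| by rewrite normr_gt0 subr_eq0 eq_sym.
suff : \forall t \near 0^'+, U (x + t * (y - x)) by [].
near=> t.
have t0 : 0 < t by near: t; exact: nbhs_right_gt.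
have t1 : t < 1 by near: t; exact: nbhs_right_lt.
have te : t < e / `|y - x| by near: t; apply: nbhs_right_lt; exact: divr_gt0.
apply: (He (x + t * (y - x))) => /=.
- rewrite opprD addNKr normrN normrM (gtr0_norm t0).
  by rewrite -ltr_pdivlMr.
- by rewrite -subr_eq0 addrC addKr mulf_eq0 gt_eqF//= subr_eq0 eq_sym.
- by apply: segA; rewrite t0 ltW.
Unshelve. all: by end_near. Qed.

Lemma cvg_diff_quotient_segment A f (x y : R) : x != y ->
  (forall t : R, 0 < t <= 1 -> A (x + t * (y - x))) -> derivable_within A f x ->
  diff_quotient f x (x + t * (y - x)) @[t --> 0^'+] --> derive_within A f x.
Proof.
move=> xy segA df.
exact: (cvg_comp _ _ (cvg_segment_within_dnbhs _ _ _ xy segA) df).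
Qed.

Lemma derive_within_ge0 A f (x y : R) : x != y ->
  (forall t : R, 0 < t <= 1 -> A (x + t * (y - x))) -> derivable_within A f x ->
  (forall z, A z -> x != z -> 0 <= diff_quotient f x z) ->
  0 <= derive_within A f x.
Proof.
move=> xy segA df f0.
apply: (cvgr_to_ge (cvg_diff_quotient_segment _ _ _ _ xy segA df)).
near=> t.
have t0 : 0 < t by near: t; exact: nbhs_right_gt.
have t1 : t < 1 by near: t; exact: nbhs_right_lt.
apply: f0; first by apply: segA; rewrite t0 ltW.
rewrite -subr_eq0 opprD addNKr oppr_eq0 mulf_eq0 gt_eqF//=.
by rewrite subr_eq0 eq_sym.
Unshelve. all: by end_near. Qed.

(** The graph of a convex function lies above its tangents.  The set [B] of
    convexity may be smaller than the set [A] to which the derivative is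
    relative. *)
Lemma convex_function_tangent A B f (x y : R) :
  @convex_function R R^o B f -> B x -> B y ->
  (forall t : R, 0 < t <= 1 -> A (x + t * (y - x))) -> derivable_within A f x ->
  f x + derive_within A f x * (y - x) <= f y.
Proof.
move=> cf Bx By segA df.
have [->|xy] := eqVneq x y; first by rewrite subrr mulr0 addr0.
have yx0 : y - x != 0 by rewrite subr_eq0 eq_sym.
rewrite -lerBrDl; set d := derive_within A f x.
have cd : diff_quotient f x (x + t * (y - x)) * (y - x) @[t --> 0^'+] -->
    d * (y - x).
  by apply: cvgM (cvg_cst _); exact: cvg_diff_quotient_segment.
apply: (cvgr_to_le cd); near=> t.
have t0 : 0 < t by near: t; exact: nbhs_right_gt.
have t1 : t < 1 by near: t; exact: nbhs_right_lt.
have := convex_function_segment _ _ _ _ t cf Bx By.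
rewrite (ltW t0) (ltW t1) => /(_ isT) le.
rewrite /diff_quotient [x + _]addrC addrK invfM mulrA mulfVK// ler_pdivrMr//.
by rewrite lerBlDl [_ * t]mulrC addrC [x + _]addrC in le *.
Unshelve. all: by end_near. Qed.

Lemma cvg_diff_quotientN A f (x : R) : derivable_within A f x ->
  diff_quotient (\- f) x y @[y --> within A x^'] --> - derive_within A f x.
Proof.
move=> df; apply: cvg_trans (cvgN df).
by apply: near_eq_cvg; near=> y; rewrite /diff_quotient -mulNr; congr (_ / _); ring.
Unshelve. all: by end_near. Qed.

Lemma derivable_withinN A f (x : R) : derivable_within A f x ->
  derivable_within A (\- f) x.
Proof.
by move=> df; apply/cvg_ex; eexists; exact: (cvg_diff_quotientN _ _ _ df).
Qed.

Lemma derive_withinN A f (x y : R) : x != y ->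
  (forall t : R, 0 < t <= 1 -> A (x + t * (y - x))) -> derivable_within A f x ->
  derive_within A (\- f) x = - derive_within A f x.
Proof.
move=> xy segA df; have dNf := derivable_withinN _ _ _ df.
have c := cvg_diff_quotient_segment _ _ _ _ xy segA dNf.
have cN := cvg_comp _ _ (cvg_segment_within_dnbhs _ _ _ xy segA)
  (cvg_diff_quotientN _ _ _ df).
exact: (cvg_unique _ c cN).
Qed.

End WithinDerivative.

(** * Functions on the nonnegative reals *)

Section NonnegReals.
Context {R : realType}.

Lemma nonneg_realsE (x : R) : @nonneg_reals R x = (0 <= x) :> Prop.
Proof. by rewrite /nonneg_reals /= in_itv /= andbT. Qed.

Lemma price_rangeE (D : R -> R) (p : R) :
  price_range D p = (0 <= p <= max_price D) :> Prop.
Proof. by rewrite /price_range /= in_itv. Qed.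

Lemma nonneg_segment (x y t : R) : 0 <= x -> 0 <= y -> 0 < t <= 1 ->
  @nonneg_reals R (x + t * (y - x)).
Proof. rewrite nonneg_realsE => x0 y0 /andP[t0 t1]; nra. Qed.

Lemma derive_nonneg_reals_ge0 (f : R -> R) (x : R) :
  (forall y z : R, 0 <= y -> y < z -> f y <= f z) ->
  0 <= x -> derivable_within nonneg_reals f x ->
  0 <= derive_within nonneg_reals f x.
Proof.
move=> homf x0 df; apply: (@derive_within_ge0 _ _ _ x (x + 1)) => //.
- by rewrite -subr_eq0 opprD addNKr oppr_eq0 oner_eq0.
- by move=> t; apply: nonneg_segment => //; lra.
move=> z; rewrite nonneg_realsE /diff_quotient => z0.
rewrite neq_lt => /orP[xz|zx].
  by rewrite divr_ge0// subr_ge0 ?(ltW xz)//; exact: homf.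
rewrite -mulrNN -invrN !opprB divr_ge0// subr_ge0 ?(ltW zx)//.
exact: homf.
Qed.

End NonnegReals.

(** * Supply of a producer facing a linear residual demand *)

Section Cost.
Context {R : realType}.

(** [supply_eq C s a q = 0] is the equation
    [(1 + s) q + s (C'(q) - C'(0)) = s a] defining the supply [q]. *)
Definition supply_eq (C : R -> R) (s a q : R) : R :=
  (1 + s) * q + s * (marginal_cost C q - marginal_cost C 0) - s * a.

(** The quantity sold at the margin [a = [p - C'(0)]_+] by a producer facing a
    residual demand of slope [- s]; it is unique, by [supply_dist], and it is 0
    when [p <= C'(0)].  The default value 0 is irrelevant for [0 <= s] and
    [0 <= a], by [supplyP]. *)
Definition supply (C : R -> R) (s a : R) : R :=
  xget 0 [set q | 0 <= q <= a /\ supply_eq C s a q = 0].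

Context {C : R -> R}.
Hypothesis hC : is_cost_function C.

Let dC (q : R) : 0 <= q -> derivable_within nonneg_reals C q.
Proof. by case: hC => _ [+ _ _] _ _ q0; apply; rewrite nonneg_realsE. Qed.

Lemma cost_tangent (q r : R) : 0 <= q -> 0 <= r ->
  C q + marginal_cost C q * (r - q) <= C r.
Proof.
move=> q0 r0; case: hC => _ _ _ cC.
apply: (convex_function_tangent _ nonneg_reals) => //; rewrite ?nonneg_realsE//.
- by move=> t; exact: nonneg_segment.
- exact: dC.
Qed.

Lemma marginal_cost_ge0 (q : R) : 0 <= q -> 0 <= marginal_cost C q.
Proof.
move=> q0; apply: derive_nonneg_reals_ge0 => //; last exact: dC.
move=> y z y0 yz; case: hC => _ _ + _; apply; rewrite ?inE ?nonneg_realsE//.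
  by rewrite (le_trans y0)// ltW.
exact: ltW.
Qed.

Lemma marginal_cost_homo (q r : R) : 0 <= q -> q <= r ->
  marginal_cost C q <= marginal_cost C r.
Proof.
move=> q0; rewrite le_eqVlt => /predU1P[->//|qr].
have r0 : 0 <= r by rewrite (le_trans q0)// ltW.
have := cost_tangent _ _ q0 r0; have := cost_tangent _ _ r0 q0.
by nra.
Qed.

Lemma marginal_cost_continuous (q : R) : 0 <= q ->
  marginal_cost C @ within nonneg_reals (nbhs q) --> marginal_cost C q.
Proof.
move=> q0; apply: Defs.derivable_within_continuous.
by case: hC => _ [_ + _] _ _; apply; rewrite nonneg_realsE.
Qed.

Lemma supplyP (s a : R) : 0 <= s -> 0 <= a ->
  0 <= supply C s a <= a /\ supply_eq C s a (supply C s a) = 0.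
Proof.
move=> s0 a0; apply: (@xgetPex _ 0 [set q | 0 <= q <= a /\ supply_eq C s a q = 0]).
have cs : {within `[0, a], continuous (supply_eq C s a)}.
  apply/subspace_continuousP => q; rewrite /= in_itv /= => /andP[q0 _].
  apply: cvgB; last exact: cvg_cst.
  apply: cvgD; apply: cvgM; try exact: cvg_cst.
    by apply: cvg_within_filter; exact: cvg_id.
  apply: cvgB; last exact: cvg_cst.
  apply: cvg_trans (marginal_cost_continuous _ q0).
  apply: cvg_app; apply: within_subset => r /=.
  by rewrite nonneg_realsE in_itv /= => /andP[].
have f0 : supply_eq C s a 0 <= 0 by rewrite /supply_eq; nra.
have fa : 0 <= supply_eq C s a a.
  by have := marginal_cost_homo _ _ (lexx 0) a0; rewrite /supply_eq; nra.
have [|q qI qE] := @IVT R _ 0 a 0 a0 cs.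
  by rewrite ge_min f0 /= le_max fa orbT.
by exists q; split => //; move: qI; rewrite in_itv.
Qed.

(** [supply_eq] is strongly increasing in [q], because [C'] is nondecreasing:
    the residual at [q] bounds the distance from [q] to the solution. *)
Lemma supply_dist (s a q : R) : 0 <= s -> 0 <= a -> 0 <= q ->
  `|q - supply C s a| <= `|supply_eq C s a q|.
Proof.
move=> s0 a0 q0; have [/andP[z0 _]] := supplyP _ _ s0 a0.
move: z0; set z := supply C s a => z0 Ez.
have E : supply_eq C s a q = (1 + s) * (q - z)
    + s * (marginal_cost C q - marginal_cost C z).
  by rewrite -[LHS]subr0 -Ez /supply_eq; ring.
case: (leP z q) => [zq|/ltW qz].
  have m := marginal_cost_homo _ _ z0 zq.
  rewrite ger0_norm ?subr_ge0// (le_trans _ (ler_norm _))// E; nra.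
have m := marginal_cost_homo _ _ q0 qz.
rewrite ler0_norm ?subr_le0// -normrN (le_trans _ (ler_norm _))// E; nra.
Qed.

(** Apply [supply_dist] at the solution for the limit parameters: its residual
    for the nearby parameters tends to 0. *)
Lemma supply_cvg {T : Type} (F : set_system T) (FF : Filter F) (f g : T -> R)
    (s a : R) : (\forall t \near F, 0 <= f t) -> (\forall t \near F, 0 <= g t) ->
  f @ F --> s -> g @ F --> a -> 0 <= s -> 0 <= a ->
  supply C (f t) (g t) @[t --> F] --> supply C s a.
Proof.
move=> f0 g0 fs ga s0 a0.
have [/andP[q0 _]] := supplyP _ _ s0 a0; set q := supply C s a in q0 * => Eq.
have c : supply_eq C (f t) (g t) q @[t --> F] --> (0 : R).
  rewrite -[X in _ --> X]Eq /supply_eq.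
  apply: cvgB; last exact: cvgM.
  apply: cvgD; apply: cvgM => //; try exact: cvg_cst.
  by apply: cvgD => //; exact: cvg_cst.
apply/cvgrPdist_le => e e0.
move/cvgr0Pnorm_le : c => /(_ e e0); apply: filterS3 f0 g0 => t ft gt.
by apply: le_trans; exact: supply_dist.
Qed.

(** The first order condition as a variational inequality.  When [C'(0) <= p] it
    is an equality; otherwise [q = 0] and the margin [p - C'(0)] is negative. *)
Lemma supply_foc (s p r : R) (q := supply C s (quantity p (marginal_cost C 0))) :
  0 <= s -> 0 <= r ->
  s * (p - q - marginal_cost C q) * (r - q) <= q * (r - q).
Proof.
move=> s0 r0; have a0 : 0 <= quantity p (marginal_cost C 0).
  by rewrite /quantity le_max lexx orbT.
have [] := supplyP _ _ s0 a0; rewrite -/q /supply_eq /quantity.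
case: (leP 0 (p - marginal_cost C 0)) => [h|/ltW h] /andP[q0 qa] E; last first.
  have -> : q = 0 by apply/le_anti; rewrite q0 qa.
  by rewrite subr0 mul0r mulr_le0_ge0 ?mulr_ge0_le0 // subr0.
suff -> : s * (p - q - marginal_cost C q) = q by [].
by lra.
Qed.

(** Among all the pairs [(p', q')] below the line of slope [- s] through
    [(p, q)], the pair [(p, q)] gives the largest utility. *)
Lemma supply_optimal (s p p' q' : R)
    (q := supply C s (quantity p (marginal_cost C 0))) :
  0 <= s -> 0 <= q' -> q' <= q - s * (p' - p) ->
  p' * q' - q' ^+ 2 / 2 - C q' <= p * q - q ^+ 2 / 2 - C q.
Proof.
move=> s0 q'0 le.
have a0 : 0 <= quantity p (marginal_cost C 0) by rewrite le_max lexx orbT.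
have [] := supplyP _ _ s0 a0; rewrite -/q /supply_eq => /andP[q0 _] E.
have foc := supply_foc _ p _ s0 q'0; rewrite -/q in foc.
have tan := cost_tangent _ _ q0 q'0.
(* If s = 0, then q = 0 and the line is flat, which forces q' = 0. *)
move: s0; rewrite le_eqVlt => /predU1P[s0|s0].
  have qz : q = 0 by rewrite -s0 in E; lra.
  have -> : q' = 0 by apply/le_anti; rewrite q'0 andbT (le_trans le)// -s0 qz; lra.
  by rewrite qz; lra.
(* Bound the gain by replacing C q' with its tangent at q, and multiply it
   by s. *)
rewrite -subr_ge0; apply: (@le_trans _ _
  (- ((p - q - marginal_cost C q) * (q' - q) + q' * (p' - p)
      - (q' - q) ^+ 2 / 2))); last by nra.
rewrite oppr_ge0 -(pmulr_rle0 _ s0).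
have h : 0 <= q' * (q - s * (p' - p) - q') by rewrite mulr_ge0// subr_ge0.
have h2 : 0 <= (1 + s / 2) * (q' - q) ^+ 2 by rewrite mulr_ge0 ?sqr_ge0//; lra.
by lra.
Qed.

Lemma supply0 (s : R) : 0 <= s -> supply C s 0 = 0.
Proof.
move=> s0; have [+ _] := supplyP _ _ s0 (lexx 0).
by move=> /andP[? ?]; apply/le_anti/andP; split.
Qed.

End Cost.

(** * Demand *)

Section Demand.
Context {R : realType}.

(** The absolute value [- D'(p)] of the slope of the demand. *)
Definition demand_slope (D : R -> R) (p : R) : R :=
  - derive_within nonneg_reals D p.

Context {D : R -> R}.
Hypothesis hD : is_demand_function D.

Lemma demand_decreasing (p r : R) : 0 <= p -> p < r -> D r < D p.
Proof.
move=> p0 pr; case: hD => _ decD _ _ _; apply: decD => //;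
by rewrite inE nonneg_realsE// (le_trans p0)// ltW.
Qed.

Let dD (p : R) : 0 <= p -> derivable_within nonneg_reals D p.
Proof. by case: hD => -[+ _ _] _ _ _ _ p0; apply; rewrite nonneg_realsE. Qed.

Let derive_within_oppD (p : R) : 0 <= p ->
  derivable_within nonneg_reals (\- D) p /\
  derive_within nonneg_reals (\- D) p = demand_slope D p.
Proof.
move=> p0; split; first exact: derivable_withinN (dD _ p0).
rewrite (derive_withinN _ _ _ (p + 1))//; last exact: dD.
- by rewrite -subr_eq0 opprD addNKr oppr_eq0 oner_eq0.
- by move=> t; apply: nonneg_segment => //; lra.
Qed.

Lemma demand_slope_ge0 (p : R) : 0 <= p -> 0 <= demand_slope D p.
Proof.
move=> p0; have [d <-] := derive_within_oppD _ p0.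
apply: derive_nonneg_reals_ge0 => // y z y0 yz.
by rewrite /= lerN2 ltW// demand_decreasing.
Qed.

Lemma demand_tangent (p r : R) : price_range D p -> price_range D r ->
  D r <= D p - demand_slope D p * (r - p).
Proof.
move=> pI rI; case: hD => _ _ _ _ cD.
have := pI; rewrite price_rangeE => /andP[p0 _].
have := rI; rewrite price_rangeE => /andP[r0 _].
have [d <-] := derive_within_oppD _ p0.
have := convex_function_tangent nonneg_reals _ _ _ _ cD pI rI _ d.
move=> /(_ (fun t => nonneg_segment _ _ t p0 r0)) /=.
by rewrite -lerN2 => h; lra.
Qed.

Lemma demand_slope_continuous (p : R) : 0 <= p ->
  demand_slope D @ within nonneg_reals (nbhs p) --> demand_slope D p.
Proof.
move=> p0; apply: cvgN; apply: Defs.derivable_within_continuous.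
by case: hD => -[_ + _] _ _ _ _; apply; rewrite nonneg_realsE.
Qed.

Lemma demand_continuous (p : R) : 0 <= p ->
  D @ within nonneg_reals (nbhs p) --> D p.
Proof. by move=> p0; apply: Defs.derivable_within_continuous; exact: dD. Qed.

Lemma max_price_gt0 : 0 < max_price D.
Proof. by have [] := demand_max_price hD. Qed.

Lemma max_price_root (p : R) : price_range D p -> D p = 0 -> p = max_price D.
Proof.
rewrite price_rangeE => /andP[p0]; rewrite le_eqVlt => /predU1P[//|pm] Dp.
by have := demand_decreasing _ _ p0 pm; rewrite Dp (demand_max_price hD).2 ltxx.
Qed.

End Demand.

Lemma quantity_ge0 {R : realType} (p a : R) : 0 <= quantity p a.
Proof. by rewrite le_max lexx orbT. Qed.

Lemma quantity_homo {R : realType} (p r a : R) :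
  p <= r -> quantity p a <= quantity r a.
Proof.
by move=> pr; rewrite /quantity ge_max !le_max lexx orbT andbT lerB.
Qed.

Lemma quantity_eq0 {R : realType} (p a : R) : p <= a -> quantity p a = 0.
Proof. by move=> pa; apply/max_idPr; rewrite subr_le0. Qed.

Lemma quantityE {R : realType} (p a : R) : a <= p -> quantity p a = p - a.
Proof. by move=> pa; apply/max_idPl; rewrite subr_ge0. Qed.

(** * Equilibria *)

Section Deviation.
Context {R : realType} {n : nat} {D : R -> R} {C : 'I_n -> R -> R}.
Hypothesis hD : is_demand_function D.
Hypothesis hC : forall i, is_cost_function (C i).
Implicit Types (x : 'I_n -> R) (i j : 'I_n).

Lemma clearing_priceP x : (forall i, price_range D (x i)) ->
  clears_market D x (clearing_price D x).
Proof. by move=> xI; apply/clearing_price_unique. Qed.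

(** The profile [x] with the bid of producer [i] replaced by [y]. *)
Definition deviation x i y : 'I_n -> R := [eta x with i |-> y].

Lemma deviation_price_range x i y : (forall j, price_range D (x j)) ->
  price_range D y -> forall j, price_range D (deviation x i y j).
Proof. by move=> xI yI j; rewrite /deviation /=; case: ifP. Qed.

Lemma deviation_supply x i y p :
  \sum_(j < n) quantity p (deviation x i y j) =
  quantity p y + \sum_(j < n | j != i) quantity p (x j).
Proof.
rewrite (bigD1 i)//= /deviation /= eqxx; congr (_ + _).
by apply: eq_bigr => j /negbTE ->.
Qed.

(** When no bid exceeds the clearing price [p], the quantity sold by a producer
    after any deviation lies below a line through the current outcome. *)
Lemma residual_demand_le x i y (p := clearing_price D x)
    (p' := clearing_price D (deviation x i y)) :
  (forall j, price_range D (x j)) -> price_range D y -> (forall j, x j <= p) ->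
  quantity p' y <= quantity p (x i) - (demand_slope D p + n.-1%:R) * (p' - p).
Proof.
move=> xI yI xp.
have [pI Dp] := clearing_priceP _ xI; rewrite -/p in pI Dp.
have [] := clearing_priceP _ (deviation_price_range _ i _ xI yI).
rewrite -/p' deviation_supply => p'I Dp'.
have tan := demand_tangent hD _ _ pI p'I.
rewrite (bigD1 i)//= in Dp.
have le : \sum_(j < n | j != i) quantity p (x j) + n.-1%:R * (p' - p) <=
    \sum_(j < n | j != i) quantity p' (x j).
  have -> : n.-1%:R * (p' - p) = \sum_(j < n | j != i) (p' - p).
    by rewrite sumr_const cardC1 card_ord mulr_natl.
  rewrite -big_split /=; apply: ler_sum => j _.
  by rewrite quantityE// addrC addrA subrK le_max lexx.
lra.
Qed.

Lemma supply_NE x (p := clearing_price D x) :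
  (forall j, price_range D (x j)) -> (forall j, x j <= p) ->
  (forall j, quantity p (x j) = supply (C j) (demand_slope D p + n.-1%:R)
     (quantity p (marginal_cost (C j) 0))) ->
  activation_price_NE D C x.
Proof.
move=> xI xp qE; split => // i y yI.
have [+ _] := clearing_priceP _ xI; rewrite price_rangeE => /andP[p0 _].
have le := residual_demand_le _ i _ xI yI xp; move: le.
rewrite /utility -/p /= eqxx -/(deviation x i y) qE => le.
apply: (supply_optimal (hC i)) le; last exact: quantity_ge0.
by rewrite addr_ge0// demand_slope_ge0.
Qed.

Lemma clearing_supply_exists : exists2 p, price_range D p &
  D p = \sum_(i < n) supply (C i) (demand_slope D p + n.-1%:R)
     (quantity p (marginal_cost (C i) 0)).
Proof.
pose s p := demand_slope D p + n.-1%:R.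
pose S p := \sum_(i < n) supply (C i) (s p) (quantity p (marginal_cost (C i) 0)).
have s0 p : 0 <= p -> 0 <= s p.
  by move=> p0; rewrite addr_ge0// demand_slope_ge0.
have m0 := ltW (max_price_gt0 hD).
have cF : {within `[0, max_price D], continuous (fun p => D p - S p)}.
  apply/subspace_continuousP => p; rewrite /= in_itv /= => /andP[p0 _].
  have sub : within `[0, max_price D] (nbhs p) `=>` within nonneg_reals (nbhs p).
    by apply: within_subset => q; rewrite nonneg_realsE /= in_itv /= => /andP[].
  apply: cvgB.
    exact: cvg_trans (cvg_app _ sub) (demand_continuous hD _ p0).
  rewrite /S; apply: (cvg_big add_continuous) => i _.
  apply: supply_cvg.
  - exact: hC.
  - apply: sub => /=; apply: nearW => q; rewrite nonneg_realsE; exact: s0.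
  - by apply: nearW => q; exact: quantity_ge0.
  - apply: cvg_trans (cvg_app _ sub) _.
    by apply: cvgD; [exact: demand_slope_continuous|exact: cvg_cst].
  - apply: cvg_within_filter.
    apply: (@continuous_max R R (fun q => q - marginal_cost (C i) 0) (cst 0)).
      by apply: cvgB; [exact: cvg_id|exact: cvg_cst].
    exact: cvg_cst.
  - exact: s0.
  - exact: quantity_ge0.
have F0 : 0 <= D 0 - S 0.
  rewrite /S big1 ?subr0; first by case: hD => _ _ /ltW.
  move=> i _; rewrite quantity_eq0 ?supply0 ?s0//.
  exact: marginal_cost_ge0.
have Fm : D (max_price D) - S (max_price D) <= 0.
  rewrite (demand_max_price hD).2 sub0r oppr_le0; apply: sumr_ge0 => i _.
  by have [/andP[]] := supplyP (hC i) _ _ (s0 _ m0) (quantity_ge0 (max_price D) (marginal_cost (C i) 0)).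
have [|p pI /eqP] := @IVT R _ 0 (max_price D) 0 m0 cF.
  by rewrite ge_min Fm orbT le_max F0.
rewrite subr_eq0 => /eqP Dp; exists p => //.
Qed.

Lemma NE_exists : exists x, activation_price_NE D C x.
Proof.
have [p pI Dp] := clearing_supply_exists.
have := pI; rewrite price_rangeE => /andP[p0 pm].
pose q i := supply (C i) (demand_slope D p + n.-1%:R)
     (quantity p (marginal_cost (C i) 0)).
have s0 : 0 <= demand_slope D p + n.-1%:R.
  by rewrite addr_ge0// demand_slope_ge0.
have qI i : 0 <= q i <= p.
  have [/andP[-> qa] _] := supplyP (hC i) _ _ s0 (quantity_ge0 p (marginal_cost (C i) 0)).
  rewrite (le_trans qa)// ge_max p0 andbT lerBlDr lerDl.
  exact: marginal_cost_ge0.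
pose x i := p - q i.
have xI i : price_range D (x i).
  by rewrite price_rangeE /x; have := qI i; lra.
have xp i : x i <= p by rewrite /x; have := qI i; lra.
have qE i : quantity p (x i) = q i by rewrite quantityE// /x; lra.
have pE : p = clearing_price D x.
  apply/clearing_price_unique => //; split => //.
  by rewrite Dp; apply: eq_bigr => i _; rewrite qE.
by exists x; apply: supply_NE; rewrite -?pE.
Qed.

(** Otherwise the producer would rather bid the maximal price and sell
    nothing. *)
Lemma NE_active_marginal_cost x i : activation_price_NE D C x ->
  x i < clearing_price D x -> marginal_cost (C i) 0 < clearing_price D x.
Proof.
move=> [xI ne] xip; rewrite ltNge; apply/negP => cp.
have mI : price_range D (max_price D).
  by rewrite price_rangeE lexx (ltW (max_price_gt0 hD)).
have := ne i _ mI; apply/negP; rewrite -ltNge.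
rewrite /utility /= eqxx -/(deviation x i _).
have [+ _] := clearing_priceP _ (deviation_price_range _ i _ xI mI).
rewrite price_rangeE => /andP[_ p'm].
rewrite (quantity_eq0 _ _ p'm) quantityE ?(ltW xip)//.
have q0 : 0 < clearing_price D x - x i by rewrite subr_gt0.
have := cost_tangent (hC i) _ _ (lexx 0) (ltW q0).
set p := clearing_price D x in cp q0 *.
have h1 : 0 <= (marginal_cost (C i) 0 - p) * (p - x i).
  by rewrite mulr_ge0// ?subr_ge0// ltW.
have h2 : 0 < (p - x i) ^+ 2 by rewrite exprn_gt0.
by rewrite mulr0 expr0n /= mul0r; lra.
Qed.

(** Otherwise the producer would rather bid slightly below the clearing
    price. *)
Lemma NE_marginal_cost_active x i : activation_price_NE D C x ->
  marginal_cost (C i) 0 < clearing_price D x -> x i < clearing_price D x.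
Proof.
move=> [xI ne]; set p := clearing_price D x => cp.
rewrite ltNge; apply/negP => px.
have [pI Dp] := clearing_priceP _ xI; rewrite -/p in pI Dp.
have := pI; rewrite price_rangeE => /andP[p0 pm].
set c := marginal_cost (C i) 0 in cp.
have c0 : 0 <= c by exact: marginal_cost_ge0.
pose d := (p - c) / 4.
have d0 : 0 < d by rewrite /d; lra.
have [e e0 mce] : exists2 e, 0 < e & forall q, 0 <= q < e ->
    marginal_cost (C i) q < c + d.
  have : nbhs c [set z | z < c + d] by apply: lt_nbhsl; lra.
  move=> /(marginal_cost_continuous (hC i) _ (lexx 0)) H.
  have [e /= e0 He] : \forall q \near 0, nonneg_reals q ->
    marginal_cost (C i) q < c + d := H.
  exists e => // q /andP[q0 qe]; apply: He; rewrite ?nonneg_realsE//=.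
  by rewrite sub0r normrN ger0_norm.
(* The bid y undercuts p by little enough that any price above y exceeds
   C_i'(0) by at least 3 d, while the quantity sold is below d and has marginal
   cost below C_i'(0) + d. *)
pose y := p - Num.min e d.
have yp : y < p by rewrite /y ltrBlDr ltrDl lt_min e0.
have yd : p - d <= y by rewrite /y lerB// ge_min lexx orbT.
have ye : p - e <= y by rewrite /y lerB// ge_min lexx.
have dp : 4 * d = p - c by rewrite /d; lra.
have yI : price_range D y by rewrite price_rangeE; lra.
have [p'I] := clearing_priceP _ (deviation_price_range _ i _ xI yI).
set p' := clearing_price D (deviation x i y) in p'I *.
rewrite deviation_supply => Dp'.
have := p'I; rewrite price_rangeE => /andP[p'0 p'm].
rewrite (bigD1 i)//= (quantity_eq0 _ _ px) add0r in Dp.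
have yp' : y < p'.
  rewrite ltNge; apply/negP => p'y; have p'p := le_lt_trans p'y yp.
  have := demand_decreasing hD _ _ p'0 p'p.
  rewrite Dp Dp' quantity_eq0// add0r; apply/negP; rewrite -leNgt.
  by apply: ler_sum => j _; apply: quantity_homo; exact: ltW.
have p'p : p' < p.
  rewrite ltNge; apply/negP => pp'.
  have : D p < D p'.
    rewrite Dp Dp' quantityE ?(ltW yp')// ltr_pwDl ?subr_gt0//.
    by apply: ler_sum => j _; exact: quantity_homo.
  rewrite ltNge => /negP; apply.
  move: pp'; rewrite le_eqVlt => /predU1P[->//|pp'].
  by apply/ltW/(demand_decreasing hD).
have := ne i _ yI; apply/negP; rewrite -ltNge.
rewrite /utility /= eqxx -/(deviation x i _) -/p -/p'.
rewrite (quantity_eq0 _ _ px) quantityE ?(ltW yp')//.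
have q0 : 0 <= p' - y by lra.
have mc : marginal_cost (C i) (p' - y) < c + d by apply: mce; lra.
have := cost_tangent (hC i) _ _ q0 (lexx 0).
have : 0 < (p' - y) * (p' - (p' - y) / 2 - marginal_cost (C i) (p' - y)).
  by apply: mulr_gt0; lra.
lra.
Qed.

Lemma NE_price_gt x c : (0 < n)%N -> activation_price_NE D C x ->
  c < max_price D -> (forall i, marginal_cost (C i) 0 = c) ->
  c < clearing_price D x.
Proof.
move=> n0 ne cm cE; rewrite ltNge; apply/negP => pc.
have [pI Dp] := clearing_priceP _ (proj1 ne).
suff pm : clearing_price D x = max_price D by rewrite pm leNgt cm in pc.
apply: (max_price_root hD) => //; rewrite Dp big1// => i _.
apply: quantity_eq0; rewrite leNgt; apply/negP => /(NE_active_marginal_cost _ _ ne).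
by rewrite cE ltNge pc.
Qed.

End Deviation.

Theorem theorem1 (R : realType) (n : nat) (hn : (0 < n)%N)
    (C : 'I_n -> R -> R) (D : R -> R)
    (hC : forall i, is_cost_function (C i)) (hD : is_demand_function D) :
  (exists x : 'I_n -> R, activation_price_NE D C x) /\
  (forall x : 'I_n -> R, activation_price_NE D C x ->
     active_set D x = [set i | marginal_cost (C i) 0 < clearing_price D x]) /\
  (forall x : 'I_n -> R, activation_price_NE D C x ->
     forall i j : 'I_n, marginal_cost (C i) 0 <= marginal_cost (C j) 0 ->
       active_set D x j -> active_set D x i) /\
  (forall x : 'I_n -> R, activation_price_NE D C x ->
     forall c : R, c < max_price D ->
       (forall i : 'I_n, marginal_cost (C i) 0 = c) ->
       active_set D x = setT).
Proof.
have act x i : activation_price_NE D C x ->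
    active_set D x i <-> marginal_cost (C i) 0 < clearing_price D x.
  move=> ne; split; first exact: (NE_active_marginal_cost hD hC).
  exact: (NE_marginal_cost_active hD hC).
split; first exact: (NE_exists hD hC).
split; first by move=> x ne; apply/seteqP; split => i /=; apply act.
split=> [x ne i j cij|x ne c cm cE].
  by rewrite !act//; exact: le_lt_trans.
apply/seteqP; split => // i _; apply/act => //; rewrite cE.
exact: (NE_price_gt hD hC).
Qed.
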